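(* Let $G$ be a finite connected $k$-regular simple graph of girth $g$, and assume that the number of distinct eigenvalues of $G$ is $d+1$. If $g\ge 2d$, then $G$ is an extremal expander graph; that is, the second-largest eigenvalue of $G$ is minimum among the second-largest eigenvalues of all $k$-regular simple graphs with the same number of vertices as $G$.
   Context: The eigenvalues of a finite graph are the eigenvalues of its adjacency matrix. The second-largest eigenvalue is taken with multiplicity counted, so that for a disconnected $k$-regular graph the largest and second-largest eigenvalues are both equal to $k$. The girth of a graph is the length of a shortest cycle. For fixed $v$ and $k$, a $k$-regular graph of order $v$ is called extremal expander if it has the minimum second-largest eigenvalue among all $k$-regular graphs of order $v$. *)

(* Defs.v *)
From mathcomp Require Import all_boot all_order all_algebra.
From mathcomp Require Import polyrcf.

Set Implicit Arguments.
Unset Strict Implicit.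
Unset Printing Implicit Defensive.

Import Order.TTheory GRing.Theory Num.Theory.
Local Open Scope ring_scope.

Record sgraph := SGraph {
  vertex :> finType;
  adj : rel vertex;
  adj_sym : symmetric adj;
  adj_irrefl : irreflexive adj
}.

Definition connected (G : sgraph) : Prop :=
  forall x y : G, connect (@adj G) x y.

Definition regular (G : sgraph) (k : nat) : Prop :=
  forall x : G, #|[set y | adj x y]| = k.

(* [ucycle] also accepts sequences of size 0 and, for a symmetric relation, of
   size 2 (an edge traversed back and forth); these are not cycles. *)
Definition graph_cycle (G : sgraph) (c : seq G) : Prop :=
  (2 < size c)%N /\ ucycle (@adj G) c.

(* [None] is the infinite girth of an acyclic graph. *)
Definition has_girth (G : sgraph) (g : option nat) : Prop :=
  match g with
  | Some n => (exists2 c : seq G, graph_cycle c & size c = n) /\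
              (forall c : seq G, graph_cycle c -> (n <= size c)%N)
  | None => forall c : seq G, ~ graph_cycle c
  end.

Definition girth_geq (g : option nat) (n : nat) : Prop :=
  match g with
  | Some m => (n <= m)%N
  | None => True
  end.

Definition adjmx (R : rcfType) (G : sgraph) : 'M[R]_#|G| :=
  \matrix_(i, j) (adj (enum_val i) (enum_val j))%:R.

(* The eigenvalues in decreasing order, each repeated according to its
   multiplicity. [rootsR p] lists the distinct roots of [p] in [R]; no
   eigenvalue is missed, since the characteristic polynomial of a symmetric
   matrix splits over a real closed field. *)
Definition spectrum (R : rcfType) (G : sgraph) : seq R :=
  let p := char_poly (adjmx R G) in
  sort >=%R (flatten [seq nseq (mup x p) x | x <- rootsR p]).

Definition distinct_eigenvalues (R : rcfType) (G : sgraph) : seq R :=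
  undup (spectrum R G).

(* Equal to 0 by default when [G] has fewer than two vertices. *)
Definition second_eigenvalue (R : rcfType) (G : sgraph) : R :=
  nth 0 (spectrum R G) 1.

Definition extremal_expander (R : rcfType) (k : nat) (G : sgraph) : Prop :=
  regular G k /\
  forall H : sgraph, regular H k -> #|H| = #|G| ->
    second_eigenvalue R G <= second_eigenvalue R H.

(* Main.v *)
Require Import Defs.
From mathcomp Require Import all_boot all_order all_algebra.
From mathcomp Require Import polyrcf complex spectral ring lra zify.

(** Let F_i be the polynomials with F_0 = 1, F_1 = X, F_2 = X^2 - k and
    F_{i+1} = X F_i - (k-1) F_{i-1} for i >= 2. For every k-regular graph with
    adjacency matrix A, the entries of F_i(A) count non-backtracking walks of
    length i ([mul_adj_nb_mx]), so they are natural numbers and every row sums to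
    F_i(k). The sums of F_i F_j over the spectrum, that is tr (F_i F_j)(A), are
    therefore nonnegative, and tr F_i(A)^2 >= n F_i(k) because a natural number is
    at most its square ([psum_nb_poly_ge0], [psum_nb_poly_sqr]). If the girth is
    at least 2d, no closed non-backtracking walk is shorter than 2d, and these
    bounds are equalities for i + j < 2d: the spectrum of G behaves like a Gauss
    quadrature for which the F_i are orthogonal ([psum_nb_polyM]).

    Let k > l = l_1 > ... > l_d be the distinct eigenvalues of G. The linear
    programming method ([no_smaller_second]) tests spectra against f = P K,
    where P = prod_i (X - l_i) and K is a positive multiple of Q = P / (X - l).
    Orthogonality gives P = F_d + c (F_0 + ... + F_{d-1}) with c > 0. With
    S_i = F_0 + ... + F_i, the Christoffel-Darboux identity expands K as a
    combination of the S_i with coefficients (k-1)^{d-1-i} S_i(l), which are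
    nonnegative because no S_i with i < d has a root at or beyond l
    ([ball_poly_gt0]). Hence f is a nonnegative combination of the F_i F_j, and
    for a k-regular graph H on n vertices with adjacency matrix B,
      tr f(B) >= tr f(A) + tr (F_d K)(B) = f(k) + tr (F_d K)(B),
    the equality because k is a simple eigenvalue of the connected graph G and f
    vanishes at the others. On the other hand f is a positive multiple of
    (X - l) Q^2, so if all the eigenvalues of H but one occurrence of k were
    below l, then tr f(B) <= f(k). Since tr (F_d K)(B) >= 0, equality would hold
    throughout: tr (F_d K)(B) would be 0, and K would vanish at all these other
    eigenvalues of H. But then tr (F_d K)(B) = F_d(k) K(k), which is positive
    ([nb_poly_degree_gt0]). *)

Set Implicit Arguments.
Unset Strict Implicit.
Unset Printing Implicit Defensive.

Import Order.TTheory GRing.Theory Num.Theory.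
Local Open Scope ring_scope.

(** * Polynomials of non-backtracking walks *)

(** The coefficient [k - (l != 0)] counts the ways to go back: a walk of length
    [l.+1] extended by one edge backtracks in one way only, which leaves a
    non-backtracking walk of length [l] followed by an edge and its reverse; the
    edge is any of [k] when [l] is [0], and must differ from the last one
    otherwise. *)
Fixpoint nb_poly (R : nzRingType) (k n : nat) : {poly R} :=
  match n with
  | 0 => 1
  | m.+1 => match m with
            | 0 => 'X
            | l.+1 => 'X * nb_poly R k m
                      - (k%:R - (l != 0%N)%:R) *: nb_poly R k l
            end
  end.

Arguments nb_poly : simpl never.

Section NbPoly.

Variables (R : rcfType) (k : nat).
Local Notation F := (nb_poly R k).
Local Notation back l := (k%:R - (l != 0%N)%:R : R).

Lemma nb_poly0 : F 0 = 1. Proof. by []. Qed.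

Lemma nb_poly1 : F 1 = 'X. Proof. by []. Qed.

Lemma nb_polySS l : F l.+2 = 'X * F l.+1 - back l *: F l.
Proof. by []. Qed.

Lemma mulX_nb_poly l : 'X * F l.+1 = F l.+2 + back l *: F l.
Proof. by rewrite nb_polySS subrK. Qed.

Lemma nb_poly_monic_size i : (F i \is monic) && (size (F i) == i.+1).
Proof.
have [m] := ubnP i; elim: m i => // m IH [|[|l]] lem.
- by rewrite nb_poly0 monic1 size_poly1.
- by rewrite nb_poly1 monicX size_polyX.
have /andP[m1 /eqP s1] := IH l.+1 lem.
have /andP[_ /eqP s0] := IH l (ltnW lem).
have sX : size ('X * F l.+1) = l.+3 by rewrite mulrC size_mulX ?monic_neq0 // s1.
have lt : (size (- (back l *: F l)) < size ('X * F l.+1)%R)%N.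
  by rewrite size_polyN sX (leq_ltn_trans (size_scale_leq _ _)) // s0.
by rewrite nb_polySS monicE lead_coefDl // size_polyDl // sX lead_coefM
  lead_coefX mul1r -monicE m1 eqxx.
Qed.

Lemma nb_poly_monic i : F i \is monic.
Proof. by have /andP[] := nb_poly_monic_size i. Qed.

Lemma size_nb_poly i : size (F i) = i.+1.
Proof. by have /andP[_ /eqP] := nb_poly_monic_size i. Qed.

Lemma nb_poly_expand m (p : {poly R}) :
  (size p <= m)%N -> exists c : nat -> R, p = \sum_(i < m) c i *: F i.
Proof.
elim: m p => [|m IH] p sp.
  by exists (fun=> 0); rewrite big_ord0; apply/eqP; rewrite -size_poly_leq0.
have [|c Ec] := IH (p - p`_m *: F m).
  apply/leq_sizeP => j; rewrite coefB coefZ leq_eqVlt => /predU1P[<-|lt].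
    have /monicP := nb_poly_monic m.
    by rewrite /lead_coef size_nb_poly /= => ->; rewrite mulr1 subrr.
  rewrite [X in _ - _ * X]nth_default ?size_nb_poly // mulr0 subr0.
  by rewrite nth_default // (leq_trans sp).
exists (fun i => if i == m then p`_m else c i).
rewrite big_ord_recr /= eqxx -[LHS](subrK (p`_m *: F m)) Ec; congr (_ + _).
by apply: eq_bigr => i _; rewrite (ltn_eqF (ltn_ord i)).
Qed.

Definition ball_poly i : {poly R} := \sum_(j < i.+1) F j.
Local Notation G := ball_poly.

Lemma ball_polyS i : G i.+1 = G i + F i.+1.
Proof. exact: big_ord_recr. Qed.

Lemma ball_poly0 : G 0 = 1.
Proof. by rewrite /G big_ord1. Qed.

(** The partial sums satisfy the recurrence without the exceptional first
    coefficient, which is what makes the Christoffel-Darboux identity for them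
    clean. They are the orthogonal polynomials for [k - X] times the measure that
    the [F i] are orthogonal for. *)
Lemma mulX_ball_poly i : 'X * G i.+1 = G i.+2 + (k%:R - 1) *: G i.
Proof.
elim: i => [|i IH].
  rewrite !ball_polyS ball_poly0 nb_polySS nb_poly0 nb_poly1 eqxx subr0.
  rewrite -!mul_polyC !polyCB; ring.
rewrite ball_polyS mulrDr {}IH mulX_nb_poly.
rewrite (ball_polyS i.+2) (ball_polyS i) scalerDr /=.
by rewrite addrACA.
Qed.

Lemma ball_poly_monic_size i : (G i \is monic) && (size (G i) == i.+1).
Proof.
case: i => [|i]; first by rewrite ball_poly0 monic1 size_poly1.
rewrite ball_polyS.
have lt : (size (G i) < size (F i.+1))%N.
  rewrite size_nb_poly ltnS; apply: (leq_trans (size_sum _ _ _)).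
  by apply/bigmax_leqP => j _; rewrite size_nb_poly.
rewrite addrC monicE lead_coefDl // size_polyDl // -monicE.
by rewrite nb_poly_monic size_nb_poly /=.
Qed.

Lemma size_ball_poly i : size (G i) = i.+1.
Proof. by have /andP[_ /eqP] := ball_poly_monic_size i. Qed.

(** Induction on [i]: by the recurrence, the right-hand side at [i.+1] is
    [('X - l) * (G i.+1).[l] *: G i.+1] plus [k - 1] times the one at [i]. *)
Lemma christoffel_darboux (l : R) i :
  ('X - l%:P) * (\sum_(j < i.+1) ((k%:R - 1) ^+ (i - j) * (G j).[l]) *: G j)
  = (G i).[l] *: G i.+1 - (G i.+1).[l] *: G i.
Proof.
elim: i => [|i IH].
  rewrite big_ord1 expr0 mul1r ball_polyS ball_poly0 nb_poly1 !hornerE.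
  by rewrite !scale1r -mul_polyC polyCD mulr1; ring.
have rec : (G i.+2).[l] = l * (G i.+1).[l] - (k%:R - 1) * (G i).[l].
  have := congr1 (horner^~ l) (mulX_ball_poly i).
  by rewrite !hornerE => ->; rewrite addrK.
rewrite big_ord_recr /= subnn expr0 mul1r mulrDr.
have -> : \sum_(j < i.+1) ((k%:R - 1) ^+ (i.+1 - j) * (G j).[l]) *: G j
  = (k%:R - 1) *: \sum_(j < i.+1) ((k%:R - 1) ^+ (i - j) * (G j).[l]) *: G j.
  rewrite scaler_sumr; apply: eq_bigr => j _.
  have le_ji : (j <= i)%N by rewrite -ltnS ltn_ord.
  by rewrite scalerA mulrA -exprS subSn.
rewrite -scalerAr {}IH rec.
have -> : G i.+2 = 'X * G i.+1 - (k%:R - 1) *: G i by rewrite mulX_ball_poly addrK.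
move: (G i) (G i.+1) (k%:R - 1) => a b c.
rewrite -!mul_polyC !(polyCB, polyCM); ring.
Qed.

End NbPoly.

(** * Power sums over a spectrum *)

Section PowerSum.

Variables (R : rcfType) (k : nat).
Local Notation F := (nb_poly R k).
Local Notation back l := (k%:R - (l != 0%N)%:R : R).

Definition psum (s : seq R) (p : {poly R}) : R := \sum_(x <- s) p.[x].

Lemma psumD s p q : psum s (p + q) = psum s p + psum s q.
Proof. by rewrite /psum -big_split; apply: eq_bigr => x _; rewrite hornerD. Qed.

Lemma psumZ s a p : psum s (a *: p) = a * psum s p.
Proof. by rewrite /psum mulr_sumr; apply: eq_bigr => x _; rewrite hornerZ. Qed.

Lemma psumB s p q : psum s (p - q) = psum s p - psum s q.
Proof. by rewrite psumD -scaleN1r psumZ mulN1r. Qed.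

Lemma psum_sum s (I : Type) (r : seq I) (P : pred I) (f : I -> {poly R}) :
  psum s (\sum_(i <- r | P i) f i) = \sum_(i <- r | P i) psum s (f i).
Proof.
rewrite /psum exchange_big; apply: eq_bigr => x _.
exact: (big_morph (horner^~ x) (fun p q => hornerD p q x) (horner0 x)).
Qed.

Lemma psum1 s : psum s 1 = (size s)%:R.
Proof.
rewrite /psum (eq_bigr (fun=> 1)) => [|x _]; last by rewrite hornerC.
by rewrite big_const_seq count_predT iter_addr_0.
Qed.

(** At [k] the recurrence collapses to a single step: a non-backtracking walk has
    [k] one-edge extensions if it is empty, and [k - 1] otherwise. *)
Lemma horner_nb_polyS i : (F i.+1).[k%:R] = back i * (F i).[k%:R].
Proof.
elim: i => [|i IH].
  by rewrite nb_poly1 nb_poly0 !hornerE eqxx subr0.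
by rewrite nb_polySS hornerD hornerN hornerZ hornerM hornerX -IH /= mulrBl mul1r.
Qed.

(** Induction on the smaller index [j], moving one factor ['X] from [F j.+2] to
    [F i.+1]. *)
Lemma psum_nb_polyM s m :
    (forall j, (0 < j < m)%N -> psum s (F j) = 0) ->
  forall i j, (i + j < m)%N ->
  psum s (F i * F j) = (size s)%:R * (F j).[k%:R] *+ (i == j).
Proof.
move=> s0.
have key j i : (j <= i)%N -> (i + j < m)%N ->
    psum s (F i * F j) = (size s)%:R * (F j).[k%:R] *+ (i == j).
  have [b] := ubnP j; elim: b j i => // b IH [|[|j]] i ltb leji ltm.
  - rewrite nb_poly0 mulr1; case: i leji ltm => [|i] _ ltm.
      by rewrite nb_poly0 hornerC mulr1 psum1.
    by rewrite s0 //; lia.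
  - case: i leji ltm => // i _ ltm.
    rewrite nb_poly1 mulrC mulX_nb_poly psumD psumZ s0 ?add0r; last lia.
    case: i ltm => [|i] ltm.
      by rewrite nb_poly0 psum1 hornerX eqxx subr0 mulrC.
    by rewrite s0 ?mulr0 //; lia.
  case: i leji ltm => // i leji ltm.
  have -> : F i.+1 * F j.+2 =
      F i.+2 * F j.+1 + back i *: (F i * F j.+1) - back j *: (F i.+1 * F j).
    rewrite nb_polySS mulrBr mulrCA mulrA mulX_nb_poly mulrDl scalerAl -scalerAr //.
  rewrite psumB psumD !psumZ IH //; try lia.
  rewrite IH //; try lia.
  rewrite IH //; try lia.
  have -> : (i.+2 == j.+1) = false by apply/eqP; lia.
  have -> : (i.+1 == j) = false by apply/eqP; lia.
  rewrite !mulr0n add0r mulr0 subr0 eqSS.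
  have [->|_] := eqVneq i j.+1; last by rewrite !mulr0n mulr0.
  by rewrite !mulr1n (horner_nb_polyS j.+1) mulrCA.
move=> i j ltm; have [leji|ltij] := leqP j i; first exact: key.
rewrite mulrC key 1?addnC //; last exact: ltnW.
by rewrite eq_sym; case: eqP => // ->.
Qed.

Lemma psum_nb_poly_orth s m i (p : {poly R}) :
    (forall j, (0 < j < m)%N -> psum s (F j) = 0) ->
  (size p <= i)%N -> (i + size p <= m)%N -> psum s (F i * p) = 0.
Proof.
move=> s0 szi szm; have [c ->] := nb_poly_expand k (leqnn (size p)).
rewrite mulr_sumr psum_sum big1 // => j _; rewrite -scalerAr psumZ.
have lt_ji : (j < i)%N by apply: leq_trans szi.
rewrite (psum_nb_polyM s0) ?gtn_eqF ?mulr0 //.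
by apply: leq_trans szm; rewrite ltn_add2l.
Qed.

End PowerSum.

(** * The linear programming bound *)

Section LinearProgramming.

Variables (R : rcfType) (k d : nat) (l : R) (s t : seq R).
Local Notation F := (nb_poly R k).
Local Notation G := (ball_poly R k).
Local Notation n := (size s).+2.
Hypothesis d_gt0 : (0 < d)%N.
Hypothesis k_gt0 : (0 < k)%N.
Hypothesis l_lt : l < k%:R.
Hypothesis s_le : {in s, forall x, x <= l}.
Hypothesis size_s : size (undup (l :: s)) = d.
Hypothesis girth : forall j, (0 < j < 2 * d)%N -> psum (k%:R :: l :: s) (F j) = 0.
Hypothesis F_gt0 : forall j, (j <= d)%N -> 0 < (F j).[k%:R].

Let rs := undup (l :: s).
Let ls_le x : x \in l :: s -> x <= l.
Proof. by rewrite inE => /predU1P[->|/s_le]. Qed.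

(** Otherwise the monic [G i] has a root [th >= l], say [G i = q * ('X - th)].
    As [(k - X) * G i] is a combination of [F i] and [F i.+1], it is orthogonal to
    [q], so the sum of [(k - x) * (x - th) * q.[x] ^+ 2] over the spectrum is [0].
    Its terms are nonpositive, hence all vanish, and [G i] has the [d] roots
    [rs], more than its degree. *)
Lemma ball_poly_gt0 i : (i < d)%N -> 0 < (G i).[l].
Proof.
move=> lt_id; rewrite ltNge; apply/negP => Gl_le0.
have [/monicP Gmon /eqP Gsz] := andP (ball_poly_monic_size R k i).
have [th le_lth rth] : exists2 th, l <= th & root (G i) th.
  have [|y yP] := @poly_pinfty_gt_lc _ (G i); first by rewrite Gmon ltr01.
  have le_l : l <= Num.max l y by rewrite le_max lexx.
  have [|th /andP[le _] r] := poly_ivt le_l (p := G i).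
    apply/andP; split=> //.
    by apply: le_trans (yP _ _); rewrite ?Gmon ?ler01 // le_max lexx orbT.
  by exists th.
case: i => [|i] in lt_id Gl_le0 Gmon Gsz rth *.
  by rewrite ball_poly0 (negPf (root1 _)) in rth.
have /factor_theorem[q Gq] := rth.
have q0 : q != 0.
  by apply: contra_eqN Gsz => /eqP q0; rewrite Gq q0 mul0r size_poly0.
have szq : size q = i.+1.
  by apply: succn_inj; rewrite -Gsz Gq size_Mmonic ?monicXsubC // size_XsubC addn2.
have kG : (k%:R%:P - 'X) * G i.+1 = (k%:R - 1) *: F i.+1 - F i.+2.
  rewrite mulrBl mulX_ball_poly !ball_polyS mul_polyC.
  rewrite !scalerBl !scalerDr !scale1r; ring.
have sum0 : psum (k%:R :: l :: s) ((k%:R%:P - 'X) * G i.+1 * q) = 0.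
  rewrite kG mulrBl -scalerAl psumB psumZ.
  rewrite !(psum_nb_poly_orth girth) ?szq ?mulr0 ?subr0 //; lia.
have Gr : {in l :: s, forall x, root (G i.+1) x}.
  move=> x xs; move/eqP: sum0; rewrite -oppr_eq0 -sumrN big_cons.
  rewrite !hornerM hornerD hornerC hornerN hornerX subrr !mul0r oppr0 add0r.
  rewrite big_seq psumr_eq0; last first.
    move=> z /ls_le lez; rewrite Gq !hornerM !(hornerD, hornerN, hornerC, hornerX).
    rewrite (_ : - _ = (k%:R - z) * (th - z) * q.[z] ^+ 2); last by ring.
    apply: mulr_ge0; last exact: sqr_ge0.
    apply: mulr_ge0; rewrite subr_ge0; first exact: le_trans (ltW l_lt).
    exact: le_trans le_lth.
  move=> /allP/(_ x xs) /=; rewrite xs /=.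
  rewrite oppr_eq0 !hornerM !mulf_eq0 hornerD hornerC hornerN hornerX subr_eq0.
  case/orP => [/orP[/eqP kx|//]|].
    by have := ls_le xs; rewrite -kx leNgt l_lt.
  by move=> qx; rewrite Gq rootM /root qx.
have : (size rs < size (G i.+1))%N.
  apply: max_poly_roots; rewrite ?undup_uniq // -?size_poly_eq0 ?Gsz //.
  by apply/allP => x; rewrite mem_undup => /Gr.
by rewrite size_s Gsz ltnS leqNgt lt_id.
Qed.

Local Notation K e := (\sum_(j < e.+1) ((k%:R - 1) ^+ (e - j) * (G j).[l]) *: G j).

(** Here [k :: l :: s] and [k :: t] stand for the spectra of two [k]-regular
    graphs of the same order; the first one comes from a graph of girth at least
    [2 * d] with [d] distinct eigenvalues besides [k], which is what [girth] and
    [size_s] retain. The test function is [P * K e], with [d = e.+1]. *)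
Theorem no_smaller_second :
    (forall i j, 0 <= psum (k%:R :: t) (F i * F j)) ->
    (forall i, n%:R * (F i).[k%:R] <= psum (k%:R :: t) (F i * F i)) ->
  exists2 x, x \in t & l <= x.
Proof.
move=> t_ge0 t_diag; apply/hasP; apply/negPn/negP => /hasPn t_lt'.
have t_lt x : x \in t -> x < l by move=> /t_lt' /=; rewrite ltNge.
have := d_gt0; case Ed: d => [//|e] _.
have le_ed j : (j < e.+1)%N -> (j < d)%N by rewrite Ed.
pose Q := \prod_(x <- rem l rs) ('X - x%:P).
pose P := \prod_(x <- rs) ('X - x%:P).
have PQ : P = ('X - l%:P) * Q.
  have lrs : l \in rs by rewrite mem_undup mem_head.
  by rewrite /P (perm_big _ (perm_to_rem lrs)) big_cons.
have P0 x : x \in l :: s -> P.[x] = 0.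
  by rewrite -mem_undup -root_prod_XsubC => /rootP.
have Pmon : P \is monic by exact: monic_prod_XsubC.
have szP : size P = e.+2 by rewrite size_prod_XsubC size_s Ed.
have Qk : 0 < Q.[k%:R].
  rewrite horner_prod big_seq prodr_gt0 // => x xr.
  rewrite hornerXsubC subr_gt0 (le_lt_trans _ l_lt) //.
  by apply: ls_le; rewrite -mem_undup; apply: mem_rem xr.
have Pk : 0 < P.[k%:R] by rewrite PQ hornerM hornerXsubC mulr_gt0 ?subr_gt0.
have sumP q : psum (k%:R :: l :: s) (P * q) = P.[k%:R] * q.[k%:R].
  rewrite /psum big_cons big_seq big1 ?addr0 ?hornerM // => x xs.
  by rewrite hornerM P0 ?mul0r.
pose m := P.[k%:R] / n%:R.
have m_gt0 : 0 < m by rewrite divr_gt0 ?ltr0n.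
(* The coefficient of P along F_j is P(k)/n for each j < d: by orthogonality
   it is (sum of P F_j over the spectrum) / (n F_j(k)), and P kills all the
   eigenvalues but k. *)
have PE : P = m *: G e + F e.+1.
  have [|c Ec] := @nb_poly_expand R k e.+1 (P - F e.+1).
    apply/leq_sizeP => j; rewrite coefB leq_eqVlt => /predU1P[<-|lt].
      have /monicP := nb_poly_monic R k e.+1; rewrite /lead_coef size_nb_poly.
      by have /monicP := Pmon; rewrite /lead_coef szP /= => -> ->; rewrite subrr.
    by rewrite !nth_default ?subrr ?size_nb_poly // szP.
  rewrite -[LHS](subrK (F e.+1)) Ec; congr (_ + _); rewrite scaler_sumr.
  apply: eq_bigr => j _; congr (_ *: _).
  have : psum (k%:R :: l :: s) (P * F j) = c j * (n%:R * (F j).[k%:R]).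
    rewrite -[P](subrK (F e.+1)) Ec mulrDl psumD mulr_suml psum_sum.
    rewrite (psum_nb_polyM girth); last by have := ltn_ord j; lia.
    rewrite gtn_eqF // addr0 (bigD1 j) //= -scalerAl psumZ.
    rewrite (psum_nb_polyM girth); last by have := ltn_ord j; lia.
    rewrite eqxx big1 ?addr0 // => i /negPf neq_ij.
    rewrite -scalerAl psumZ (psum_nb_polyM girth); last first.
      by have := ltn_ord j; have := ltn_ord i; lia.
    by rewrite -val_eqE /= in neq_ij; rewrite neq_ij mulr0.
  have Fj0 : (F j).[k%:R] != 0 by rewrite gt_eqF ?F_gt0 // ltnW // le_ed.
  rewrite sumP mulrA => /(mulIf Fj0) Pkc.
  by rewrite /m Pkc mulfK // pnatr_eq0.
have PG : P = G e.+1 + (m - 1) *: G e.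
  by rewrite PE ball_polyS -!mul_polyC polyCB; ring.
have g_gt0 : 0 < (G e).[l] by apply/ball_poly_gt0/le_ed.
(* P(l) = 0 identifies the right-hand side of the Christoffel-Darboux
   identity with a multiple of P. *)
have KE : K e = (G e).[l] *: Q.
  apply: (@mulfI _ ('X - l%:P)); first by rewrite polyXsubC_eq0.
  rewrite christoffel_darboux -scalerAr -PQ PG scalerDr; congr (_ + _).
  have : P.[l] = 0 by apply: P0; rewrite mem_head.
  rewrite PG hornerD hornerZ scalerA => /eqP; rewrite addr_eq0 => /eqP ->.
  by rewrite scaleNr opprK mulrC.
have szK : (size (K e) <= e.+1)%N.
  rewrite (leq_trans (size_sum _ _ _)) //; apply/bigmax_leqP => j _.
  by rewrite (leq_trans (size_scale_leq _ _)) // size_ball_poly.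
have w_ge0 j : (j < e.+1)%N -> 0 <= (k%:R - 1) ^+ (e - j) * (G j).[l].
  move=> /le_ed/ball_poly_gt0/ltW Gj.
  by rewrite mulr_ge0 // exprn_ge0 // subr_ge0 ler1n.
have mono i j : (i < e.+1)%N -> (j < e.+1)%N ->
    psum (k%:R :: l :: s) (F i * F j) <= psum (k%:R :: t) (F i * F j).
  move=> lti ltj; rewrite (psum_nb_polyM girth); last by lia.
  by case: eqP => [<-|_]; rewrite ?mulr1n // mulr0n.
have monoGK : psum (k%:R :: l :: s) (G e * K e) <= psum (k%:R :: t) (G e * K e).
  rewrite !mulr_sumr !psum_sum; apply: ler_sum => j _.
  rewrite -!scalerAr !psumZ ler_wpM2l ?w_ge0 //.
  rewrite !mulr_sumr !psum_sum; apply: ler_sum => a _.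
  rewrite !mulr_suml !psum_sum; apply: ler_sum => i _.
  by rewrite mono // (leq_trans (ltn_ord a)).
have FK_ge0 : 0 <= psum (k%:R :: t) (F e.+1 * K e).
  rewrite !mulr_sumr !psum_sum; apply: sumr_ge0 => j _.
  rewrite -!scalerAr !psumZ mulr_ge0 ?w_ge0 //.
  by rewrite !mulr_sumr !psum_sum; apply: sumr_ge0 => a _; apply: t_ge0.
have PK_le0 x : x \in t -> 0 <= - (P * K e).[x].
  move=> /t_lt/ltW lexl; rewrite PQ KE !hornerM hornerZ hornerXsubC.
  rewrite (_ : - _ = (l - x) * (G e).[l] * Q.[x] ^+ 2); last by ring.
  by apply: mulr_ge0; [apply: mulr_ge0; rewrite ?subr_ge0 // ltW | exact: sqr_ge0].
(* P K splits as m (G_e K) + F_d K. On the spectrum k :: l :: s the second part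
   sums to 0 by orthogonality, and the first part can only grow on k :: t. *)
have bound : psum (k%:R :: t) (F e.+1 * K e) + \sum_(x <- t) - (P * K e).[x] <= 0.
  have := sumP (K e); rewrite {1}PE mulrDl psumD -scalerAl psumZ.
  rewrite (psum_nb_poly_orth girth) // ?addr0; last first.
    by rewrite Ed mul2n -addnn leq_add2l.
  have : psum (k%:R :: t) (P * K e) =
      P.[k%:R] * (K e).[k%:R] + \sum_(x <- t) (P * K e).[x].
    by rewrite /psum big_cons hornerM.
  rewrite {1}PE mulrDl psumD -scalerAl psumZ sumrN.
  have := monoGK; rewrite -(ler_pM2l m_gt0).
  set a := m * psum _ _; set b := m * psum _ _; set u := psum _ _.
  set v := \sum_(x <- t) _; set w := P.[_] * _.
  move: a b u v w => a b u v w.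
  lra.
have sumPK : 0 <= \sum_(x <- t) - (P * K e).[x].
  by rewrite big_seq sumr_ge0.
have Kt x : x \in t -> (K e).[x] = 0.
  move=> xt; have : \sum_(x <- t) - (P * K e).[x] = 0 by lra.
  rewrite big_seq => /eqP; rewrite psumr_eq0 // => /allP/(_ x xt) /=.
  rewrite xt /= oppr_eq0 KE PQ !hornerM hornerZ hornerXsubC !mulf_eq0.
  rewrite subr_eq0 (lt_eqF (t_lt x xt)) (gt_eqF g_gt0) /= orbb => /eqP ->.
  by rewrite mulr0.
have : psum (k%:R :: t) (F e.+1 * K e) = (F e.+1).[k%:R] * (K e).[k%:R].
  rewrite /psum big_cons hornerM [X in _ + X]big1_seq ?addr0 // => x /andP[_ xt].
  by rewrite hornerM Kt ?mulr0.
have : 0 < (F e.+1).[k%:R] * (K e).[k%:R].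
  by rewrite KE hornerZ !mulr_gt0 // F_gt0 // Ed.
lra.
Qed.

End LinearProgramming.

(** * Non-backtracking walks and cycles *)

Section Walks.

Variable G : sgraph.
Implicit Types x y z u : G.

(** The edge from [x] to [z] is the first of a non-backtracking walk of length
    [i.+1]; carrying it along is what makes the count recursive. *)
Fixpoint nb_from (i : nat) x z y : nat :=
  match i with
  | 0 => z == y
  | j.+1 => \sum_(u | adj z u && (u != x)) nb_from j z u y
  end.

Definition nb_count (i : nat) x y : nat :=
  match i with
  | 0 => x == y
  | j.+1 => \sum_(z | adj x z) nb_from j x z y
  end.

(** A non-backtracking walk of length [i.+1] from a neighbour [z] of [x] either
    extends by [x] to a non-backtracking one, or starts with the edge back to [x];
    removing this edge leaves a walk of length [i] from [x] that does not start
    with [z], whence the factor [k - 1], or [k] if it is empty. *)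
Lemma nb_countSS i k x y : regular G k ->
  (\sum_(z | adj x z) nb_count i.+1 z y
   = nb_count i.+2 x y + (k - (i != 0)) * nb_count i x y)%N.
Proof.
move=> hreg.
have deg (v : G) : (\sum_(z | adj v z) 1 = k)%N.
  by rewrite sum1_card -(hreg v); apply: eq_card => z; rewrite inE.
have -> : (\sum_(z | adj x z) nb_count i.+1 z y
           = nb_count i.+2 x y + \sum_(z | adj x z) nb_from i z x y)%N.
  rewrite /= -big_split; apply: eq_bigr => z xz.
  by rewrite (bigD1 x) /= 1?adj_sym // addnC.
congr (_ + _)%N; case: i => [|i] /=.
  by rewrite subn0 -(deg x) big_distrl; apply: eq_bigr => z _ /=; rewrite mul1n.
rewrite (exchange_big_dep (fun u => adj x u)) => [|z u _ /andP[]] //=.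
rewrite big_distrr; apply: eq_bigr => u xu /=.
rewrite (eq_bigl (fun z => adj x z && (z != u))) => [|z]; last first.
  by rewrite xu eq_sym.
rewrite -[in LHS](mul1n (nb_from _ _ _ _)) -big_distrl /=; congr (_ * _)%N.
by rewrite -(deg x) [in RHS](bigD1 u) //= addnC addnK.
Qed.

Lemma nb_from_walk i x z y : adj x z -> (0 < nb_from i x z y)%N ->
  exists f : nat -> G, [/\ f 0 = x, f 1 = z, f i.+1 = y,
    forall j, (j <= i)%N -> adj (f j) (f j.+1) &
    forall j, (j < i)%N -> f j != f j.+2].
Proof.
elim: i x z => [|i IH] x z xz /=.
  rewrite lt0b => /eqP <-; exists (fun j => if j is _.+1 then z else x).
  by split=> // j; rewrite leqn0 => /eqP ->.
rewrite lt0n sum_nat_eq0 => /forallPn[u]; rewrite negb_imply -lt0n.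
move=> /andP[/andP[zu ux] /(IH _ _ zu)[f [f0 f1 fi fadj fnb]]].
exists (fun j => if j is j'.+1 then f j' else x); split=> //.
  by case=> [|j] lt; [rewrite f0 | apply: fadj].
by case=> [|j] lt; [rewrite f1 eq_sym | apply: fnb].
Qed.

(** If a vertex repeats before the end, the segment between two of its
    occurrences is a shorter closed walk, still non-backtracking inside.
    A closed walk without repetition is a cycle: its length is not 1 since there
    are no loops, nor 2 since the walk does not backtrack. *)
Lemma closed_walk_cycle m (f : nat -> G) : (0 < m)%N -> f m = f 0%N ->
    (forall j, (j < m)%N -> adj (f j) (f j.+1)) ->
    (forall j, (j.+1 < m)%N -> f j != f j.+2) ->
  exists2 c : seq G, graph_cycle c & (size c <= m)%N.
Proof.
have [b] := ubnP m; elim: b m f => // b IH m f ltb m_gt0 fm fadj fnb.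
have [Uf|] := boolP (uniq (mkseq f m)); last first.
  move=> /(uniqPn (f 0))[i [j [ltij]]]; rewrite size_mkseq => ltjm.
  rewrite !nth_mkseq ?(ltn_trans ltij) // => fij.
  have [|||l ltl|l ltl|c cc sc] := IH (j - i)%N (fun l => f (i + l)%N); try lia.
  - by rewrite addn0 subnKC // ltnW.
  - by rewrite addnS; apply: fadj; lia.
  - by rewrite !addnS; apply: fnb; lia.
  by exists c => //; lia.
exists (mkseq f m); last by rewrite size_mkseq.
have [m2 | ] := ltnP 2 m; last first.
  case: m m_gt0 fm fadj fnb {ltb Uf} => [|[|[|]]] // _ fm fadj fnb.
    by have := fadj 0%N isT; rewrite fm adj_irrefl.
  by have := fnb 0%N isT; rewrite fm eqxx.
split; first by rewrite size_mkseq.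
rewrite /ucycle Uf andbT.
case: m m_gt0 fm fadj {fnb m2 ltb Uf} => // m _ fm fadj.
have -> : mkseq f m.+1 = f 0%N :: mkseq (f \o succn) m.
  by rewrite /mkseq /= -[1%N]/(1 + 0)%N iotaDl -map_comp.
rewrite /cycle -fm -[f m.+1]/((f \o succn) m) -mkseqS.
apply/(pathP (f 0%N)) => i; rewrite size_mkseq => lti.
rewrite nth_mkseq //=; case: i lti => [|i] lti /=; first by rewrite fm; apply: fadj.
by rewrite nth_mkseq ?fadj // ltnW.
Qed.

Lemma nb_count_girth m x : (0 < m)%N ->
  (forall c : seq G, graph_cycle c -> (m < size c)%N) -> nb_count m x x = 0%N.
Proof.
case: m => // m _ hc; apply/eqP; rewrite sum_nat_eq0; apply/forallP => z.
apply/implyP => xz; apply/negPn; rewrite -lt0n; apply/negP.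
move=> /(nb_from_walk xz)[f [f0 _ fm fadj fnb]].
have [||||c cc] := @closed_walk_cycle m.+1 f => //; first by rewrite fm.
by rewrite leqNgt hc.
Qed.

End Walks.

(** * Diagonalization of the adjacency matrix *)

Section Diagonalization.

Variable R : rcfType.
Local Notation toC := (real_complex R).

(** The spectral theorem is applied over the algebraic closure [R[i]], where a
    real symmetric matrix is Hermitian; its eigenvalues are then real. Only the
    eigenvalues [r], not the basis [P], have to be brought back to [R]. *)
Lemma symmetric_diag n (A : 'M[R]_n) : A^T = A ->
  exists P : 'M[R[i]]_n, exists2 r : 'rV[R]_n, P \in unitmx &
    P *m map_mx toC A = diag_mx (map_mx toC r) *m P.
Proof.
move=> symA; pose B := map_mx toC A.
have realB : B \is a mxOver Num.real.
  by apply/mxOverP => i j; rewrite mxE complex_real.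
have hermB : B \is hermsymmx.
  apply: realsym_hermsym => //.
  apply/is_hermitianmxP; rewrite expr0 scale1r; apply/matrixP => i j.
  by rewrite !mxE -[in LHS]symA mxE.
have /orthomx_spectralP EB := hermitian_normalmx hermB.
exists (spectralmx B), (map_mx (@complex.Re R) (spectral_diag B)).
  exact: spectral_unit.
have -> : map_mx toC (map_mx (@complex.Re R) (spectral_diag B)) = spectral_diag B.
  apply/matrixP => i j; rewrite !mxE RRe_real //.
  exact: (mxOverP (hermitian_spectral_diag_real hermB)).
by rewrite -/B {2}EB !mulmxA mulmxV ?spectral_unit // mul1mx.
Qed.

(** Similarity phrased as an intertwining relation, so that no inverse appears. *)
Lemma char_poly_intertwine (F : fieldType) n (A D P : 'M[F]_n) :
  P \in unitmx -> P *m A = D *m P -> char_poly A = char_poly D.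
Proof.
move=> uP PA; have detP0 : \det (map_mx polyC P) != 0.
  by rewrite det_map_mx polyC_eq0 -unitfE -unitmxE.
apply: (mulfI detP0); rewrite /char_poly [RHS]mulrC -!det_mulmx; congr (\det _).
rewrite /char_poly_mx mulmxBr mulmxBl -!map_mxM PA; congr (_ - _).
by rewrite scalar_mxC.
Qed.

Lemma char_poly_real_diag n (A : 'M[R]_n) (P : 'M[R[i]]_n) (r : 'rV[R]_n) :
    P \in unitmx -> P *m map_mx toC A = diag_mx (map_mx toC r) *m P ->
  char_poly A = \prod_(x <- [seq r 0 i | i : 'I_n]) ('X - x%:P).
Proof.
move=> uP PA.
apply: (map_poly_inj toC); rewrite map_char_poly (char_poly_intertwine uP PA).
rewrite char_poly_trig ?diag_mx_is_trig // rmorph_prod big_map big_enum /=.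
apply: eq_bigr => i _.
by rewrite !mxE eqxx mulr1n rmorphB /= map_polyX map_polyC.
Qed.

Variable G : sgraph.
Local Notation n := #|G|.
Local Notation A := (adjmx R G).

Lemma adjmx_sym : A^T = A.
Proof. by apply/matrixP => i j; rewrite !mxE adj_sym. Qed.

Lemma spectrum_perm (P : 'M[R[i]]_n) (r : 'rV[R]_n) :
  P \in unitmx -> P *m map_mx toC A = diag_mx (map_mx toC r) *m P ->
  perm_eq (spectrum R G) [seq r 0 i | i : 'I_n].
Proof.
move=> uP PA; rewrite /spectrum perm_sort.
rewrite (char_poly_real_diag uP PA).
set s := [seq _ | i : _]; set p := \prod_(x <- s) _.
have p0 : p != 0 by rewrite monic_neq0 // monic_prod_XsubC.
apply/allP => x _ /=; rewrite count_flatten -map_comp sumnE big_map.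
under eq_bigr do rewrite /= count_nseq.
have Ux : uniq (rootsR p) by apply: uniq_roots.
have xP : (x \in rootsR p) = (x \in s).
  by rewrite -(roots_on_rootsR p0) in_itv /= root_prod_XsubC.
have [xs|xns] := boolP (x \in s).
  rewrite (bigD1_seq x) ?xP //= eqxx mul1n big1 ?addn0 ?mu_prod_XsubC //.
  by move=> y /negPf ->.
rewrite (count_memPn xns) big1_seq // => y /andP[_ yr]; rewrite /=.
by case: (y =P x) => // yx; rewrite yx xP (negPf xns) in yr.
Qed.

Lemma spectrum_sorted : sorted >=%R (spectrum R G).
Proof. by apply: sort_sorted => x y; apply: le_total. Qed.

Definition nb_mx i : 'M[R]_n :=
  \matrix_(a, b) (nb_count i (enum_val a) (enum_val b))%:R.

Lemma sum_enum_val (V : nmodType) (f : G -> V) :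
  \sum_(x : G) f x = \sum_(a < n) f (enum_val a).
Proof. exact: (big_enum_val (A := G)). Qed.

Variable k : nat.
Hypothesis k_gt0 : (0 < k)%N.
Hypothesis hreg : regular G k.

Lemma nb_mx0 : nb_mx 0 = 1%:M.
Proof. by apply/matrixP => a b; rewrite !mxE /= (inj_eq enum_val_inj). Qed.

Lemma nb_mx1 : nb_mx 1 = A.
Proof.
apply/matrixP => a b; rewrite !mxE /=; congr (_%:R).
rewrite big_mkcond (bigD1 (enum_val b)) //= eqxx big1 => [|z /negPf ->].
  by rewrite addn0; case: ifP.
by case: ifP.
Qed.

Lemma mul_adj_nb_mx i :
  A *m nb_mx i.+1 = nb_mx i.+2 + (k%:R - (i != 0%N)%:R) *: nb_mx i.
Proof.
apply/matrixP => a b; rewrite !mxE -natrB ?(leq_trans (leq_b1 _)) //.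
rewrite -natrM -natrD -(nb_countSS _ _ _ hreg) natr_sum.
rewrite [in RHS]big_mkcond [RHS]sum_enum_val; apply: eq_bigr => c _; rewrite !mxE.
by case: ifP => _; rewrite ?mul1r ?mul0r.
Qed.

Lemma nb_mx_sym i : (nb_mx i)^T = nb_mx i.
Proof.
suff [] : (nb_mx i)^T = nb_mx i /\ A *m nb_mx i = nb_mx i *m A by [].
have [m] := ubnP i; elim: m i => // m IH [|[|i]] lti.
- by rewrite nb_mx0 trmx1 mulmx1 mul1mx.
- by rewrite nb_mx1 adjmx_sym.
have [t1 c1] := IH i.+1 lti; have [t0 c0] := IH i (ltnW lti).
have -> : nb_mx i.+2 = A *m nb_mx i.+1 - (k%:R - (i != 0%N)%:R) *: nb_mx i.
  by rewrite mul_adj_nb_mx addrK.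
split.
  by rewrite linearB linearZ /= trmx_mul adjmx_sym t1 t0 c1.
by rewrite mulmxBr mulmxBl -!scalemxAr -!scalemxAl c0 {1}c1 mulmxA.
Qed.

(** In a basis that diagonalizes the adjacency matrix, [nb_mx i] becomes
    diagonal with entries [F i] at the eigenvalues, since both sides satisfy the
    same recurrence. *)
Lemma trace_nb_mx i j :
  \tr (nb_mx i *m nb_mx j) = psum (spectrum R G) (nb_poly R k i * nb_poly R k j).
Proof.
have [P [r uP PA]] := symmetric_diag adjmx_sym.
have PM l : P *m map_mx toC (nb_mx l) =
    diag_mx (map_mx toC (map_mx (fun x => (nb_poly R k l).[x]) r)) *m P.
  have [m] := ubnP l; elim: m l => // m IH [|[|l]] ltl.
  - rewrite nb_mx0 map_mx1 mulmx1 (_ : diag_mx _ = 1%:M) ?mul1mx //.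
    by apply/matrixP => a b; rewrite !mxE nb_poly0 hornerC.
  - rewrite nb_mx1 PA; congr (diag_mx _ *m _).
    by apply/matrixP => a b; rewrite !mxE nb_poly1 hornerX.
  have -> : nb_mx l.+2 = A *m nb_mx l.+1 - (k%:R - (l != 0%N)%:R) *: nb_mx l.
    by rewrite mul_adj_nb_mx addrK.
  rewrite map_mxB map_mxM map_mxZ mulmxBr -scalemxAr mulmxA PA -mulmxA.
  rewrite (IH l.+1 ltl) (IH l (ltnW ltl)) mulmxA scalemxAl -mulmxBl.
  congr (_ *m _); rewrite mul_diag_mx; apply/matrixP => a b.
  rewrite !mxE; case: (a == b); last by rewrite !mulr0n !mulr0 subr0.
  rewrite !mulr1n nb_polySS hornerD hornerN hornerZ hornerM hornerX.
  rewrite [RHS](rmorphB toC) [X in _ = X - _](rmorphM toC).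
  by rewrite [X in _ = _ - X](rmorphM toC).
apply: (fmorph_inj toC); rewrite -trace_map_mx map_mxM.
rewrite -[X in \tr X]mul1mx -(mulVmx uP) -mulmxA mxtrace_mulC.
rewrite mulmxA PM -mulmxA -mulmxA [_ *m (_ *m invmx P)]mulmxA PM.
rewrite -mulmxA mulmxV // mulmx1.
rewrite mulmx_diag mxtrace_diag /psum (perm_big _ (spectrum_perm uP PA)).
rewrite big_map big_enum /=.
rewrite rmorph_sum; apply: eq_bigr => a _.
by rewrite !mxE hornerM rmorphM.
Qed.

Lemma row_sum_nb_mx i a : \sum_b nb_mx i a b = (nb_poly R k i).[k%:R].
Proof.
suff E : nb_mx i *m const_mx 1 = const_mx (nb_poly R k i).[k%:R] :> 'cV_n.
  have := congr1 (fun M : 'cV_n => M a 0) E; rewrite !mxE => <-.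
  by apply: eq_bigr => b _; rewrite !mxE mulr1.
have A1 c : A *m const_mx c = const_mx (k%:R * c) :> 'cV_n.
  apply/matrixP => b o; rewrite !mxE -(hreg (enum_val b)) -sum1_card natr_sum.
  rewrite mulr_suml [in RHS]big_mkcond [RHS]sum_enum_val; apply: eq_bigr => e _.
  by rewrite !mxE inE; case: (adj _ _); rewrite ?mul1r ?mul0r.
have [m] := ubnP i; elim: m i => // m IH [|[|i]] lti.
- by rewrite nb_mx0 mul1mx nb_poly0 hornerC.
- by rewrite nb_mx1 A1 nb_poly1 hornerX mulr1.
have -> : nb_mx i.+2 = A *m nb_mx i.+1 - (k%:R - (i != 0%N)%:R) *: nb_mx i.
  by rewrite mul_adj_nb_mx addrK.
rewrite mulmxBl -mulmxA -scalemxAl IH // IH 1?ltnW // A1.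
apply/matrixP => b o; rewrite !mxE nb_polySS.
by rewrite hornerD hornerN hornerZ hornerM hornerX.
Qed.

Lemma size_spectrum : size (spectrum R G) = n.
Proof.
have [P [r uP PA]] := symmetric_diag adjmx_sym.
by rewrite (perm_size (spectrum_perm uP PA)) size_map -cardE card_ord.
Qed.

Lemma psum_nb_poly_ge0 i j :
  0 <= psum (spectrum R G) (nb_poly R k i * nb_poly R k j).
Proof.
rewrite -trace_nb_mx; apply: sumr_ge0 => a _; rewrite mxE.
by apply: sumr_ge0 => b _; rewrite !mxE mulr_ge0.
Qed.

Lemma psum_nb_poly_sqr i :
  n%:R * (nb_poly R k i).[k%:R]
    <= psum (spectrum R G) (nb_poly R k i * nb_poly R k i).
Proof.
rewrite -trace_nb_mx mulr_natl -[X in _ *+ X]card_ord -sumr_const.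
apply: ler_sum => a _; rewrite -(row_sum_nb_mx i a) mxE.
apply: ler_sum => b _; rewrite -{3}(nb_mx_sym i) !mxE -natrM ler_nat.
by case: (nb_count _ _ _) => // e; rewrite leq_pmulr.
Qed.

End Diagonalization.

(** * The largest eigenvalue of a regular graph *)

Section Perron.

Variables (K : numClosedFieldType) (G : sgraph) (k : nat).
Hypothesis hreg : regular G k.
Variables (v : G -> K) (lam : K).
Hypothesis eig : forall x, \sum_(y | adj x y) v y = lam * v x.

(** The quadratic form of the Laplacian, evaluated at an eigenvector. Its being
    nonnegative bounds the eigenvalues by [k], and its vanishing forces an
    eigenvector for [k] to be constant along edges. *)
Lemma dirichlet_energy :
  \sum_(x : G) \sum_(y | adj x y) `|v x - v y| ^+ 2
  = 2 * (k%:R - lam) * \sum_(x : G) `|v x| ^+ 2.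
Proof.
have deg (x : G) (a : K) : \sum_(y | adj x y) a = k%:R * a.
  rewrite big_const iter_addr_0 mulr_natl; congr (_ *+ _).
  by rewrite -(hreg x); apply: eq_card => y; rewrite inE.
have flip (f : G -> G -> K) : \sum_(x : G) \sum_(y | adj x y) f x y
    = \sum_(x : G) \sum_(y | adj x y) f y x.
  rewrite (exchange_big_dep predT) //=; apply: eq_bigr => x _.
  by apply: eq_bigl => y; rewrite adj_sym.
have E1 : \sum_(x : G) \sum_(y | adj x y) v x * (v x)^*
    = k%:R * \sum_(x : G) v x * (v x)^*.
  by rewrite mulr_sumr; apply: eq_bigr => x _; apply: deg.
have E2 : \sum_(x : G) \sum_(y | adj x y) v y * (v x)^*
    = lam * \sum_(x : G) v x * (v x)^*.
  by rewrite mulr_sumr; apply: eq_bigr => x _; rewrite -mulr_suml eig mulrA.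
transitivity (\sum_(x : G) \sum_(y | adj x y) v x * (v x)^*
   + \sum_(x : G) \sum_(y | adj x y) v y * (v y)^*
   - (\sum_(x : G) \sum_(y | adj x y) v y * (v x)^*
      + \sum_(x : G) \sum_(y | adj x y) v x * (v y)^*)).
  rewrite -!big_split -sumrB; apply: eq_bigr => x _ /=.
  rewrite -!big_split -sumrB; apply: eq_bigr => y _ /=.
  by rewrite normCK rmorphB /=; ring.
rewrite (flip (fun x y => v y * (v y)^*)) (flip (fun x y => v x * (v y)^*)) /= E1 E2.
under [in RHS]eq_bigr => x _ do rewrite normCK.
ring.
Qed.

Hypothesis v_neq0 : exists x, v x != 0.

Lemma eigenvalue_le_degree : lam \is Num.real -> lam <= k%:R.
Proof.
move=> lam_real; have [x vx] := v_neq0.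
have S_gt0 : 0 < \sum_(x : G) `|v x| ^+ 2.
  rewrite (bigD1 x) //= ltr_pwDl ?exprn_gt0 ?normr_gt0 //.
  by apply: sumr_ge0 => y _; rewrite exprn_ge0.
rewrite -subr_ge0 -(pmulr_lge0 _ S_gt0) -(pmulr_rge0 _ (ltr0Sn K 1)) mulrA.
rewrite -dirichlet_energy; apply: sumr_ge0 => y _; apply: sumr_ge0 => z _.
by rewrite exprn_ge0.
Qed.

Lemma top_eigenvector_const : connected G -> lam = k%:R -> forall x y, v x = v y.
Proof.
move=> hconn lamk; have := dirichlet_energy; rewrite lamk subrr mulr0 mul0r => E0.
have vadj x y : adj x y -> v x = v y.
  move=> xy; have ge0 a : 0 <= \sum_(b | adj a b) `|v a - v b| ^+ 2.
    by apply: sumr_ge0 => b _; rewrite exprn_ge0.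
  have := psumr_eq0P (fun a _ => ge0 a) E0 (i := x) isT.
  move/psumr_eq0P => /(_ (fun b _ => exprn_ge0 2 (normr_ge0 _)) y xy)/eqP.
  by rewrite expf_eq0 /= normr_eq0 subr_eq0 => /eqP.
move=> x y; have /connectP[p pp ->] := hconn x y.
elim: p x pp => //= z p IH x /andP[/vadj -> /IH]; exact.
Qed.

End Perron.

Section RegularSpectrum.

Variables (R : rcfType) (G : sgraph) (k : nat).
Hypothesis hreg : regular G k.
Local Notation n := #|G|.

Local Notation toC := (real_complex R).

Lemma degree_in_spectrum : (0 < n)%N -> k%:R \in spectrum R G.
Proof.
move=> n_gt0; have [P [r uP PA]] := symmetric_diag (adjmx_sym R G).
have : eigenvalue (adjmx R G) k%:R.
  apply/eigenvalueP; exists (const_mx 1).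
    apply/rowP => b; rewrite !mxE mulr1 -(hreg (enum_val b)) -sum1_card natr_sum.
    rewrite [in RHS]big_mkcond [RHS]sum_enum_val; apply: eq_bigr => a _.
    by rewrite !mxE inE mul1r adj_sym; case: (adj _ _).
  by apply/eqP => /rowP/(_ (Ordinal n_gt0)); rewrite !mxE => /eqP; rewrite oner_eq0.
rewrite eigenvalue_root_char (perm_mem (spectrum_perm uP PA)).
by rewrite (char_poly_real_diag uP PA) root_prod_XsubC.
Qed.

Section Rows.

Variables (P : 'M[R[i]]_n) (r : 'rV[R]_n).
Hypothesis uP : P \in unitmx.
Hypothesis PA : P *m map_mx toC (adjmx R G) = diag_mx (map_mx toC r) *m P.

Lemma diag_row_eig i (x : G) :
  \sum_(y | adj x y) P i (enum_rank y) = toC (r 0 i) * P i (enum_rank x).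
Proof.
have /matrixP/(_ i (enum_rank x)) := PA; rewrite mul_diag_mx !mxE => <-.
rewrite big_mkcond sum_enum_val; apply: eq_bigr => a _; rewrite enum_valK !mxE.
rewrite enum_rankK adj_sym; case: (adj _ _).
  by rewrite [toC _](rmorph1 toC) mulr1.
by rewrite [toC _](rmorph0 toC) mulr0.
Qed.

Lemma diag_row_neq0 i : exists x : G, P i (enum_rank x) != 0.
Proof.
have [/existsP//|/existsPn P0] := boolP [exists x : G, P i (enum_rank x) != 0].
have : delta_mx 0 i *m P = 0 :> 'rV_n.
  rewrite -rowE; apply/rowP => b; rewrite !mxE.
  by have := P0 (enum_val b); rewrite enum_valK negbK => /eqP.
move=> /(congr1 (mulmx^~ (invmx P))); rewrite mulmxK // mul0mx => /rowP/(_ i)/eqP.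
by rewrite !mxE !eqxx oner_eq0.
Qed.

End Rows.

Lemma spectrum_le_degree x : x \in spectrum R G -> x <= k%:R.
Proof.
have [P [r uP PA]] := symmetric_diag (adjmx_sym R G).
rewrite (perm_mem (spectrum_perm uP PA)) => /mapP[i _ ->].
have := eigenvalue_le_degree hreg (diag_row_eig PA i) (diag_row_neq0 uP i).
by rewrite complex_real eqxx -(rmorph_nat toC) lecR; apply.
Qed.

(** Two distinct rows of the diagonalizing matrix with eigenvalue [k] would both
    be constant, hence linearly dependent. *)
Lemma degree_simple : connected G -> (count_mem k%:R (spectrum R G) <= 1)%N.
Proof.
move=> hconn; have [P [r uP PA]] := symmetric_diag (adjmx_sym R G).
rewrite (permP (spectrum_perm uP PA)) count_map -sum1_count big_enum_cond /=.
rewrite sum1_card; apply/card_le1_eqP => i j; rewrite !unfold_in /=.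
move=> /eqP ri /eqP rj.
have const l : r 0 l = k%:R -> forall a b, P l a = P l b.
  move=> rl a b; rewrite -(enum_valK a) -(enum_valK b).
  apply: (top_eigenvector_const hreg (diag_row_eig PA l) hconn).
  by rewrite rl rmorph_nat.
apply/eqP; apply/negPn/negP => neq_ij.
have [x Pix] := diag_row_neq0 uP i.
set a := P i (enum_rank x) in Pix; set b := P j (enum_rank x).
have : (b *: delta_mx 0 i - a *: delta_mx 0 j) *m P = 0 :> 'rV_n.
  rewrite mulmxBl -!scalemxAl -!rowE; apply/rowP => c; rewrite !mxE.
  by rewrite (const i ri c (enum_rank x)) (const j rj c (enum_rank x)) mulrC subrr.
move=> /(congr1 (mulmx^~ (invmx P))); rewrite mulmxK // mul0mx => /rowP/(_ j)/eqP.
rewrite !mxE !eqxx (negPf neq_ij) /= mulr0 mulr1 sub0r oppr_eq0.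
by rewrite (negPf Pix).
Qed.

End RegularSpectrum.

(** * Extremality *)

(** [F j] at [k] is a row sum of the nonnegative matrix [nb_mx j]. If it
    vanished, so would the matrix, and then every one of the [d.+1] distinct
    eigenvalues would be a root of [F j], whose degree is at most [d]. This covers
    [k = 1], where [F j] does vanish at [k] for [j >= 2]. *)
Lemma nb_poly_degree_gt0 (R : rcfType) (G : sgraph) (k d : nat) :
    regular G k -> (0 < k)%N ->
    size (distinct_eigenvalues R G) = d.+1 ->
  forall j, (j <= d)%N -> 0 < (nb_poly R k j).[k%:R].
Proof.
move=> hreg k_gt0 hdist j lejd.
have n_gt0 : (0 < #|G|)%N.
  rewrite -(size_spectrum R G) lt0n size_eq0; apply: contra_eqN hdist => /eqP sp.
  by rewrite /distinct_eigenvalues sp.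
have row a := row_sum_nb_mx R k_gt0 hreg j a.
have ge0 a b : 0 <= nb_mx R G j a b by rewrite mxE.
rewrite lt0r -{2}(row (Ordinal n_gt0)) sumr_ge0 // andbT; apply/eqP => Fk0.
have M0 : nb_mx R G j = 0.
  apply/matrixP => a b; rewrite [RHS]mxE.
  by have := row a; rewrite Fk0 => /psumr_eq0P; apply.
have F0 : {in distinct_eigenvalues R G, forall x, root (nb_poly R k j) x}.
  move=> x; rewrite mem_undup => xs.
  have := trace_nb_mx R k_gt0 hreg j j; rewrite M0 mul0mx mxtrace0 => /esym/eqP.
  rewrite /psum psumr_eq0 => [/allP/(_ x xs)|z _] /=.
    by rewrite hornerM mulf_eq0 orbb.
  by rewrite hornerM -expr2 sqr_ge0.
have : (size (distinct_eigenvalues R G) < size (nb_poly R k j))%N.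
  apply: max_poly_roots; rewrite ?undup_uniq ?monic_neq0 ?nb_poly_monic //.
  exact/allP.
by rewrite size_nb_poly hdist ltnS ltnNge lejd.
Qed.

Lemma sorted_ge_head (R : rcfType) (x : R) s :
  sorted >=%R (x :: s) -> {in s, forall y, y <= x}.
Proof. by move=> /(order_path_min ge_trans)/allP. Qed.

Lemma connected_degree_gt0 (G : sgraph) k :
  connected G -> regular G k -> (1 < #|G|)%N -> (0 < k)%N.
Proof.
move=> hconn hreg n_gt1; have /card_gt1P[x [y [_ _ neq_xy]]] := n_gt1.
have /connectP[p pp yp] := hconn x y.
case: p pp yp => [_ yx|z p /= /andP[xz _] _]; first by rewrite yx eqxx in neq_xy.
by rewrite -(hreg x); apply/card_gt0P; exists z; rewrite inE.
Qed.

Lemma connected_spectrum (R : rcfType) (G : sgraph) k :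
    connected G -> regular G k -> (0 < #|G|)%N ->
  exists2 s, spectrum R G = k%:R :: s & {in s, forall x, x < k%:R}.
Proof.
move=> hconn hreg n_gt0.
have kin := degree_in_spectrum R hreg n_gt0.
have le_k := @spectrum_le_degree R _ _ hreg.
have := degree_simple R hreg hconn; have := spectrum_sorted R G.
case: (spectrum R G) kin le_k => // x s kin le_k /sorted_ge_head hx.
have -> : x = k%:R.
  apply/le_anti; rewrite le_k ?mem_head //=.
  by move: kin; rewrite inE => /predU1P[-> //|/hx].
rewrite /= eqxx add1n ltnS leqn0 => /eqP/count_memPn ks; exists s => // y ys.
rewrite lt_neqAle le_k ?inE ?ys ?orbT // andbT.
by apply: contraNneq ks => <-.
Qed.

Lemma psum_nb_poly_girth (R : rcfType) (G : sgraph) k m :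
    regular G k -> (0 < k)%N -> (0 < m)%N ->
    (forall c : seq G, graph_cycle c -> (m < size c)%N) ->
  psum (spectrum R G) (nb_poly R k m) = 0.
Proof.
move=> hreg k_gt0 m_gt0 hc; rewrite -[nb_poly R k m]mulr1 -[1](nb_poly0 R k).
rewrite -trace_nb_mx // nb_mx0 mulmx1; apply: big1 => a _.
by rewrite mxE nb_count_girth.
Qed.

Theorem theorem5 (R : rcfType) (G : sgraph) (k d : nat) (g : option nat)
    (hconn : connected G) (hreg : regular G k) (hgirth : has_girth G g)
    (hdist : size (distinct_eigenvalues R G) = d.+1)
    (hgd : girth_geq g (2 * d)) :
  extremal_expander R k G.
Proof.
split=> // H hregH cardH.
have long_cycles (c : seq G) : graph_cycle c -> (2 * d <= size c)%N.
  case: g hgirth hgd => [m [_ hm] le_dm|hN _] hc; last by case: (hN c).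
  exact: leq_trans (hm c hc).
have n_gt0 : (0 < #|G|)%N.
  rewrite -(size_spectrum R G) lt0n size_eq0; apply: contra_eqN hdist => /eqP sp.
  by rewrite /distinct_eigenvalues sp.
have [s Es lt_k] := connected_spectrum R hconn hreg n_gt0.
have sz_s : size (undup s) = d.
  apply: succn_inj; rewrite -hdist /distinct_eigenvalues Es /=.
  by case: ifP => // /lt_k; rewrite ltxx.
rewrite leNgt; apply/negP; rewrite /second_eigenvalue Es /=.
have sizeG := size_spectrum R G; have sizeH := size_spectrum R H.
rewrite Es in sizeG.
(* With a single vertex both second eigenvalues are the default value. *)
case: s Es lt_k sz_s sizeG => [|l s] Es lt_k sz_s sizeG.
  by rewrite nth_default ?ltxx // sizeH cardH -sizeG.
have sortG := spectrum_sorted R G; rewrite Es in sortG.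
have sortH := spectrum_sorted R H.
have le_l : {in s, forall x, x <= l} by apply: sorted_ge_head (path_sorted sortG).
have l_lt : l < k%:R by apply: lt_k; rewrite mem_head.
have k_gt0 : (0 < k)%N by apply: (connected_degree_gt0 hconn hreg); rewrite -sizeG.
have d_gt0 : (0 < d)%N.
  by rewrite -sz_s lt0n size_eq0; apply/eqP => /undup_nil.
have kH : k%:R \in spectrum R H by apply: degree_in_spectrum; rewrite // cardH.
have posH := psum_nb_poly_ge0 R k_gt0 hregH.
have diagH := psum_nb_poly_sqr R k_gt0 hregH.
rewrite cardH -sizeG in diagH.
case EH : (spectrum R H) => [|x [|y t]] /=.
- by rewrite EH in kH.
- by move: sizeH; rewrite EH cardH -sizeG.
move=> lt_yl; rewrite EH in kH sortH posH diagH.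
have le_y : {in y :: t, forall z, z <= y}.
  move=> z; rewrite inE => /predU1P[-> //|].
  exact: sorted_ge_head (path_sorted sortH) z.
(* k occurs in the spectrum of H, and all the entries but the first are below
   l < k. *)
have xk : x = k%:R.
  move: kH; rewrite inE => /predU1P[-> //|/le_y].
  by rewrite leNgt (lt_trans lt_yl l_lt).
rewrite xk in posH diagH.
have girthG j : (0 < j < 2 * d)%N -> psum (k%:R :: l :: s) (nb_poly R k j) = 0.
  move=> /andP[j_gt0 lt_jd]; rewrite -Es; apply: psum_nb_poly_girth => // c.
  by move=> /long_cycles; apply: leq_trans.
have posF := nb_poly_degree_gt0 hreg k_gt0 hdist.
have [z zt] := no_smaller_second d_gt0 k_gt0 l_lt le_l sz_s girthG posF posH diagH.
by rewrite leNgt (le_lt_trans (le_y z zt) lt_yl).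
Qed.
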